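(* Let $n\ge 2$. The quotient inverse monoid $C_n = D_n/{\equiv}$ (the Cuntz inverse monoid) is a Boolean inverse $\wedge$-monoid whose group of units is (isomorphic to) the Thompson group $G_{n,1} = D_n^{e}/\sigma$.
   Context: Inverse semigroups: the natural partial order is $a\le b$ iff $a=ba^{-1}a$; elements $a,b$ are compatible, $a\sim b$, if $a^{-1}b$ and $ab^{-1}$ are both idempotents. An inverse monoid is distributive if each pair of compatible elements has a join and multiplication distributes over such joins; a distributive inverse monoid is Boolean if its idempotents form a Boolean algebra under the natural partial order. A $\wedge$-monoid is an inverse monoid in which each pair of elements has a meet with respect to the natural partial order. Let $A_n$ be an alphabet with $n\ge 2$ letters and $A_n^{*}$ the free monoid on it. A right ideal of $A_n^{*}$ is a set of the form $XA_n^{*}$ with $X\subseteq A_n^{*}$; it is finitely generated if $X$ can be chosen finite ($X=\varnothing$ is allowed). A morphism $\theta:R_1\to R_2$ between right ideals is a function with $\theta(rs)=\theta(r)s$ for all $r\in R_1$, $s\in A_n^{*}$. $D_n$ is the set of all bijective morphisms between finitely generated right ideals of $A_n^{*}$ (including the empty function $0$); it is an inverse monoid under composition of partial functions. For an inverse semigroup $S$ with zero, write $x^{\downarrow}=\{y: y\le x\}$. The Lenz congruence $\equiv$ on $S$ is: $s\equiv t$ iff for each $0<x\le s$ we have $x^{\downarrow}\cap t^{\downarrow}\ne\{0\}$ and for each $0<y\le t$ we have $y^{\downarrow}\cap s^{\downarrow}\neq\{0\}$. It is a congruence. A non-zero idempotent $e$ of an inverse semigroup $S$ with zero is essential if $ef\ne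 0$ for every non-zero idempotent $f$. $S^{e}$ denotes the set of $a\in S$ such that both $a^{-1}a$ and $aa^{-1}$ are essential; it is an inverse subsemigroup not containing $0$. On an inverse semigroup, $\sigma$ is the minimum group congruence: $a\,\sigma\, b$ iff there is $c$ with $c\le a$ and $c\le b$. The Thompson group $G_{n,1}$ is defined to be $D_n^{e}/\sigma$. *)

(* Defs.v *)
From HB Require Import structures.
From mathcomp Require Import all_boot all_order.
From mathcomp Require Import boolp classical_sets cardinality.

Set Implicit Arguments.
Unset Strict Implicit.
Unset Printing Implicit Defensive.

Local Open Scope classical_set_scope.
Local Open Scope quotient_scope.
Local Open Scope group_scope.

Definition idempotent_elt (S : magmaType) (e : S) : Prop := e * e = e.

(* That inversion is an involutive anti-automorphism (the StarMonoid part)    *)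
(* follows from regularity and uniqueness; it is kept as a superclass so that *)
(* the library lemmas on `_^-1 apply.                                         *)
HB.mixin Record StarMonoid_isInverse S of StarMonoid S := {
  mulgVg : forall a : S, a * a^-1 * a = a;
  invg_unique : forall a b : S, a * b * a = a -> b * a * b = b -> b = a^-1
}.

#[short(type="inverseMonoidType")]
HB.structure Definition InverseMonoid :=
  {S of StarMonoid_isInverse S & StarMonoid S}.

(* The equational presentation, convenient for quotients and submonoids. *)
HB.factory Record StarMonoid_isInverse_eq S of StarMonoid S := {
  mulgVg : forall a : S, a * a^-1 * a = a;
  mulgV_comm : forall a b : S, commute (a * a^-1) (b * b^-1)
}.

HB.builders Context S of StarMonoid_isInverse_eq S.

Fact mulVgV (a : S) : a^-1 * a * a^-1 = a^-1.
Proof. by rewrite -{2}[a]invgK mulgVg. Qed.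

Fact mulVg_comm (a b : S) : commute (a^-1 * a) (b * b^-1).
Proof. by rewrite -{2}[a]invgK; apply: mulgV_comm. Qed.

Fact idemV (e : S) : idempotent_elt e -> e^-1 = e.
Proof.
move=> ee; have eV : e^-1 = (e^-1 * e) * (e * e^-1).
  by rewrite mulgA -(mulgA _ e e) ee mulVgV.
have/(congr1 inv) := eV.
by rewrite !invgM !invgK -mulVg_comm -eV.
Qed.

Fact idemE (e : S) : idempotent_elt e -> e = e * e^-1.
Proof. by move=> ee; rewrite (idemV ee) ee. Qed.

Fact idemC (e f : S) : idempotent_elt e -> idempotent_elt f -> commute e f.
Proof. by move=> /idemE -> /idemE ->; apply: mulgV_comm. Qed.

Fact invg_unique (a b : S) : a * b * a = a -> b * a * b = b -> b = a^-1.
Proof.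
move=> aba bab.
have iba : idempotent_elt (b * a) by rewrite /idempotent_elt mulgA bab.
have iab : idempotent_elt (a * b) by rewrite /idempotent_elt mulgA aba.
have iVa : idempotent_elt (a^-1 * a) by rewrite /idempotent_elt mulgA mulVgV.
have iaV : idempotent_elt (a * a^-1) by rewrite /idempotent_elt mulgA mulgVg.
have Eb : b = a^-1 * a * b.
  transitivity ((b * a) * (a^-1 * a) * b).
    by rewrite -!mulgA (mulgA a) (mulgA (a * _)) mulgVg mulgA bab.
  by rewrite (idemC iba iVa) -mulgA bab.
have Ea : a^-1 = a^-1 * (a * b) * (a * a^-1).
  by rewrite -!mulgA (mulgA a) (mulgA (a * _)) aba mulgA mulVgV.
by rewrite [RHS]Ea -mulgA (idemC iab iaV) !mulgA mulVgV.
Qed.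

HB.instance Definition _ := StarMonoid_isInverse.Build S mulgVg invg_unique.

HB.end.

Section InverseMonoidTheory.
Variable S : inverseMonoidType.
Implicit Types a b c d e f : S.

(* The natural partial order. *)
Definition npo_le a b : Prop := a = b * a^-1 * a.

Definition compatible a b : Prop :=
  idempotent_elt (a^-1 * b) /\ idempotent_elt (a * b^-1).

Definition is_join a b c : Prop :=
  [/\ npo_le a c, npo_le b c & forall d, npo_le a d -> npo_le b d -> npo_le c d].

Definition is_meet a b c : Prop :=
  [/\ npo_le c a, npo_le c b & forall d, npo_le d a -> npo_le d b -> npo_le d c].

Lemma mulVgV a : a^-1 * a * a^-1 = a^-1.
Proof. by rewrite -{2}[a]invgK mulgVg. Qed.

Lemma idempotentV e : idempotent_elt e -> e^-1 = e.
Proof. by move=> ee; apply/esym/invg_unique; rewrite !ee. Qed.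

Lemma idempotent1 : idempotent_elt (1 : S).
Proof. exact: mulg1. Qed.

Lemma idempotent_Vg a : idempotent_elt (a^-1 * a).
Proof. by rewrite /idempotent_elt mulgA mulVgV. Qed.

Lemma idempotent_gV a : idempotent_elt (a * a^-1).
Proof. by rewrite /idempotent_elt mulgA mulgVg. Qed.

Lemma idempotentM e f :
  idempotent_elt e -> idempotent_elt f -> idempotent_elt (e * f).
Proof.
move=> ee ff; pose x := (e * f)^-1.
have xx : f * x * e = x.
  apply: invg_unique.
    by rewrite !mulgA -(mulgA _ f f) ff -(mulgA _ e e) ee -mulgA mulgVg.
  have h := mulVgV (e * f); rewrite -/x in h.
  by rewrite -[in RHS]h !mulgA -(mulgA _ e e) ee -(mulgA _ f f) ff.
have ix : idempotent_elt x.
  have h := mulVgV (e * f); rewrite -/x in h.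
  by rewrite /idempotent_elt -{1}xx -{2}xx -[in RHS]xx -{3}h !mulgA.
by rewrite -[e * f]invgK -/x (idempotentV ix).
Qed.

Lemma idempotentC e f : idempotent_elt e -> idempotent_elt f -> commute e f.
Proof.
move=> ee ff; rewrite /commute -(idempotentV (idempotentM ee ff)) invgM.
by rewrite !idempotentV.
Qed.

Lemma idempotentJ a e : idempotent_elt e -> idempotent_elt (a * e * a^-1).
Proof.
move=> ee; rewrite /idempotent_elt !mulgA -(mulgA _ _ a) -(mulgA _ _ (_ * a)).
by rewrite (idempotentC ee (idempotent_Vg a)) !mulgA mulgVg -(mulgA a e) ee.
Qed.

Lemma npo_leP a b : npo_le a b <-> exists2 e, idempotent_elt e & a = b * e.
Proof.
split=> [ab|[e ee ->]].
  by exists (a^-1 * a); [exact: idempotent_Vg | rewrite mulgA].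
rewrite /npo_le invgM (idempotentV ee).
have -> : b * (e * b^-1) * (b * e) = b * (e * (b^-1 * b)) * e by rewrite !mulgA.
by rewrite (idempotentC ee (idempotent_Vg b)) !mulgA mulgVg -mulgA ee.
Qed.

Lemma npo_lePl a b : npo_le a b <-> exists2 e, idempotent_elt e & a = e * b.
Proof.
split=> [/npo_leP[e ee ->]|[e ee ->]].
  exists (b * e * b^-1); first exact: idempotentJ.
  by rewrite -!mulgA (idempotentC ee (idempotent_Vg b)) !mulgA mulgVg.
apply/npo_leP; exists (b^-1 * e * b).
  by have := idempotentJ b^-1 ee; rewrite invgK.
by rewrite !mulgA -(idempotentC ee (idempotent_gV b)) -!mulgA (mulgA b) mulgVg.
Qed.

Lemma npo_le_refl a : npo_le a a.
Proof. by rewrite /npo_le mulgVg. Qed.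

Lemma npo_le_trans b a c : npo_le a b -> npo_le b c -> npo_le a c.
Proof.
move=> /npo_leP[e ee ->] /npo_leP[f ff ->]; apply/npo_leP.
by exists (f * e); [exact: idempotentM | rewrite mulgA].
Qed.

Lemma npo_leMl c a b : npo_le a b -> npo_le (c * a) (c * b).
Proof. by move=> /npo_leP[e ee ->]; apply/npo_leP; exists e; rewrite ?mulgA. Qed.

Lemma npo_leMr c a b : npo_le a b -> npo_le (a * c) (b * c).
Proof. by move=> /npo_lePl[e ee ->]; apply/npo_lePl; exists e; rewrite ?mulgA. Qed.

Lemma npo_leM a b c d : npo_le a b -> npo_le c d -> npo_le (a * c) (b * d).
Proof. by move=> ab cd; apply: npo_le_trans (npo_leMr _ ab) (npo_leMl _ cd). Qed.

Lemma npo_leV a b : npo_le a b -> npo_le a^-1 b^-1.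
Proof.
move=> /npo_lePl[e ee ->]; apply/npo_leP; exists e => //.
by rewrite invgM (idempotentV ee).
Qed.

Lemma npo_leVg a : npo_le (a^-1 * a) 1.
Proof.
by apply/npo_leP; exists (a^-1 * a); rewrite ?mul1g//; exact: idempotent_Vg.
Qed.

Lemma npo_leVgl a b : npo_le (a^-1 * (a * b)) b.
Proof.
apply/npo_lePl; exists (a^-1 * a); rewrite ?mulgA//; exact: idempotent_Vg.
Qed.

End InverseMonoidTheory.

Definition distributive_inverse (S : inverseMonoidType) : Prop :=
  (forall a b : S, compatible a b -> exists c, is_join a b c) /\
  (forall a b c d : S, compatible a b -> is_join a b c ->
     is_join (d * a) (d * b) (d * c) /\ is_join (a * d) (b * d) (c * d)).

(* The poset of idempotents is order isomorphic to a complemented bounded     *)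
(* distributive lattice B.                                                    *)
Definition idempotents_boolean_algebra (S : inverseMonoidType) : Prop :=
  exists (disp : Order.disp_t) (B : ctbDistrLatticeType disp) (h : B -> S),
    [/\ forall x y : B, (x <= y)%O <-> npo_le (h x) (h y),
        forall x : B, idempotent_elt (h x)
      & forall e : S, idempotent_elt e -> exists x : B, h x = e].

Definition boolean_inverse (S : inverseMonoidType) : Prop :=
  distributive_inverse S /\ idempotents_boolean_algebra S.

Definition meet_monoid (S : inverseMonoidType) : Prop :=
  forall a b : S, exists c, is_meet a b c.

Section Units.
Variable S : inverseMonoidType.

Definition is_unit (a : S) : Prop := exists b : S, a * b = 1 /\ b * a = 1.

Definition unit_pred : pred S := fun a => `[< is_unit a >].

Record units := Units { units_val :> S; units_valP : unit_pred units_val }.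

HB.instance Definition _ := [isSub for units_val].
HB.instance Definition _ := [Choice of units by <:].

Lemma is_unitV (a : S) : is_unit a -> a * a^-1 = 1 /\ a^-1 * a = 1.
Proof.
by case=> b [ab ba]; rewrite -(@invg_unique _ a b) ?ab ?ba ?mul1g.
Qed.

Fact unit_monoid_closed : monoid_closed unit_pred.
Proof.
split; first by apply/asboolP; exists 1; rewrite mulg1.
move=> a b /asboolP[a' [aa' a'a]] /asboolP[b' [bb' b'b]].
apply/asboolP; exists (b' * a'); split.
  by rewrite -mulgA (mulgA b) bb' mul1g.
by rewrite -mulgA (mulgA a') a'a mul1g.
Qed.

HB.instance Definition _ :=
  SubChoice_isSubMonoid.Build S unit_pred units unit_monoid_closed.

Fact units_invP (u : units) : unit_pred (val u)^-1.
Proof.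
by have /asboolP/is_unitV[uV Vu] := valP u; apply/asboolP; exists (val u).
Qed.

HB.instance Definition _ := hasInv.Build units (fun u => Units (units_invP u)).

Fact units_mulVg : left_inverse 1 inv (@mul units).
Proof.
move=> u; apply: val_inj; rewrite valM val1.
by have /asboolP/is_unitV[] := valP u.
Qed.

Fact units_mulgV : right_inverse 1 inv (@mul units).
Proof.
move=> u; apply: val_inj; rewrite valM val1.
by have /asboolP/is_unitV[] := valP u.
Qed.

HB.instance Definition _ := Monoid_isGroup.Build units units_mulVg units_mulgV.

End Units.

Section MinimumGroupCongruence.
Variable S : inverseMonoidType.
Implicit Types a b c d : S.

Definition sigma a b : Prop := exists c, npo_le c a /\ npo_le c b.

Lemma sigma_refl a : sigma a a.
Proof. by exists a; split; exact: npo_le_refl. Qed.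

Lemma sigma_sym a b : sigma a b -> sigma b a.
Proof. by case=> c [ca cb]; exists c. Qed.

Lemma sigma_trans b a c : sigma a b -> sigma b c -> sigma a c.
Proof.
case=> x [xa /npo_leP[e ee ex]] [y [/npo_leP[f ff fy] yc]].
have ef := idempotentC ee ff.
exists (b * e * f); split.
  by apply: npo_le_trans xa; rewrite -ex; apply/npo_leP; exists f.
apply: npo_le_trans yc; rewrite -mulgA ef mulgA -fy.
by apply/npo_leP; exists e.
Qed.

Lemma sigmaM a b c d : sigma a b -> sigma c d -> sigma (a * c) (b * d).
Proof.
by case=> x [xa xb] [y [yc yd]]; exists (x * y); split; exact: npo_leM.
Qed.

Lemma sigmaV a b : sigma a b -> sigma a^-1 b^-1.
Proof. by case=> x [xa xb]; exists x^-1; split; exact: npo_leV. Qed.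

Definition sigma_rel : rel S := fun a b => `[< sigma a b >].

Fact sigma_equiv : equiv_class_of sigma_rel.
Proof.
split=> [a|a b|b a c].
- by apply/asboolP; exact: sigma_refl.
- by apply/asboolP/asboolP; exact: sigma_sym.
- by move=> /asboolP ab /asboolP bc; apply/asboolP; exact: sigma_trans bc.
Qed.

Canonical sigma_equiv_rel := EquivRelPack sigma_equiv.

Definition sigma_quot := {eq_quot sigma_rel}.

HB.instance Definition _ := Choice.on sigma_quot.
HB.instance Definition _ := EqQuotient.on sigma_quot.

Lemma sigma_quotP a b : \pi_sigma_quot a = \pi_sigma_quot b <-> sigma a b.
Proof.
split=> [/eqmodP/asboolP //|ab]; apply/eqmodP; exact/asboolP.
Qed.

Lemma sigma_quotW (x : sigma_quot) : exists a, x = \pi_sigma_quot a.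
Proof. by exists (repr x); rewrite reprK. Qed.

Definition sigma_mul (x y : sigma_quot) : sigma_quot :=
  \pi_sigma_quot (repr x * repr y).
Definition sigma_inv (x : sigma_quot) : sigma_quot :=
  \pi_sigma_quot (repr x)^-1.

Lemma pi_sigma_mul a b :
  sigma_mul (\pi_sigma_quot a) (\pi_sigma_quot b) = \pi_sigma_quot (a * b).
Proof. by apply/sigma_quotP/sigmaM; apply/sigma_quotP; rewrite reprK. Qed.

Lemma pi_sigma_inv a : sigma_inv (\pi_sigma_quot a) = \pi_sigma_quot a^-1.
Proof. by apply/sigma_quotP/sigmaV; apply/sigma_quotP; rewrite reprK. Qed.

Fact sigma_mulA : associative sigma_mul.
Proof.
move=> x y z; case: (sigma_quotW x) => a ->; case: (sigma_quotW y) => b ->.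
case: (sigma_quotW z) => c ->.
by rewrite !pi_sigma_mul mulgA.
Qed.

Fact sigma_mul1g : left_id (\pi_sigma_quot 1) sigma_mul.
Proof.
by move=> x; case: (sigma_quotW x) => a ->; rewrite pi_sigma_mul mul1g.
Qed.

Fact sigma_mulg1 : right_id (\pi_sigma_quot 1) sigma_mul.
Proof.
by move=> x; case: (sigma_quotW x) => a ->; rewrite pi_sigma_mul mulg1.
Qed.

Fact sigma_mulVg : left_inverse (\pi_sigma_quot 1) sigma_inv sigma_mul.
Proof.
move=> x; case: (sigma_quotW x) => a ->.
rewrite pi_sigma_inv pi_sigma_mul; apply/sigma_quotP.
by exists (a^-1 * a); split; [exact: npo_le_refl|exact: npo_leVg].
Qed.

Fact sigma_mulgV : right_inverse (\pi_sigma_quot 1) sigma_inv sigma_mul.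
Proof.
move=> x; case: (sigma_quotW x) => a ->.
rewrite pi_sigma_inv pi_sigma_mul -{1}[a]invgK.
apply/sigma_quotP.
by exists (a^-1^-1 * a^-1); split; [exact: npo_le_refl|exact: npo_leVg].
Qed.

HB.instance Definition _ := isGroup.Build sigma_quot
  sigma_mulA sigma_mul1g sigma_mulg1 sigma_mulVg sigma_mulgV.

End MinimumGroupCongruence.

(* Inverse monoids with zero, non-trivial so that 1 is an essential           *)
(* idempotent.                                                                *)
HB.mixin Record InverseMonoid_hasZero S of InverseMonoid S := {
  zerog : S;
  mul0g : left_zero zerog (@mul S);
  mulg0 : right_zero zerog (@mul S);
  oneg_neq0 : (1 : S) <> zerog
}.

#[short(type="inverseMonoid0Type")]
HB.structure Definition InverseMonoid0 :=
  {S of InverseMonoid_hasZero S & InverseMonoid S}.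

Section LenzCongruence.
Variable S : inverseMonoid0Type.
Local Notation "0" := (@zerog S).
Implicit Types a b c d s t u x y : S.

Definition down x : set S := [set y | npo_le y x].

Definition lenz s t : Prop :=
  (forall x, x <> 0 -> npo_le x s -> down x `&` down t <> [set 0]) /\
  (forall y, y <> 0 -> npo_le y t -> down y `&` down s <> [set 0]).

Lemma zerog_le a : npo_le 0 a.
Proof. by rewrite /npo_le mulg0. Qed.

Lemma invg0 : 0^-1 = 0.
Proof. by apply/esym/invg_unique; rewrite !mul0g. Qed.

Lemma down_meetP x t : down x `&` down t <> [set 0] <->
  exists z, [/\ z <> 0, npo_le z x & npo_le z t].
Proof.
split=> [xt|[z [z0 zx zt]] xt]; last first.
  by apply: z0; have : (down x `&` down t) z by []; rewrite xt.
apply: contrapT => nz; apply: xt; apply/seteqP; split=> z /=.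
  by case=> zx zt; apply: contrapT => z0; apply: nz; exists z.
by move=> ->; split; exact: zerog_le.
Qed.

Lemma lenzP s t : lenz s t <->
  (forall x, x <> 0 -> npo_le x s ->
     exists z, [/\ z <> 0, npo_le z x & npo_le z t]) /\
  (forall x, x <> 0 -> npo_le x t ->
     exists z, [/\ z <> 0, npo_le z x & npo_le z s]).
Proof.
by split=> -[st ts]; split=> x x0 xs; apply/down_meetP; auto.
Qed.

Lemma lenz_refl s : lenz s s.
Proof.
by apply/lenzP; split=> x x0 xs; exists x; split=> //; exact: npo_le_refl.
Qed.

Lemma lenz_sym s t : lenz s t -> lenz t s.
Proof. by case. Qed.

Lemma lenz_trans t s u : lenz s t -> lenz t u -> lenz s u.
Proof.
move=> /lenzP[st ts] /lenzP[tu ut]; apply/lenzP; split=> x x0.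
  move=> /(st _ x0)[y [y0 yx]] /(tu _ y0)[z [z0 zy zu]].
  by exists z; split=> //; exact: npo_le_trans yx.
move=> /(ut _ x0)[y [y0 yx]] /(ts _ y0)[z [z0 zy zu]].
by exists z; split=> //; exact: npo_le_trans yx.
Qed.

Lemma lenzMl c s t : lenz s t -> lenz (c * s) (c * t).
Proof.
suff H a b x : (forall x, x <> 0 -> npo_le x a ->
    exists z, [/\ z <> 0, npo_le z x & npo_le z b]) ->
    x <> 0 -> npo_le x (c * a) ->
    exists z, [/\ z <> 0, npo_le z x & npo_le z (c * b)].
  by move=> /lenzP[st ts]; apply/lenzP; split=> x; exact: H.
move=> ab x0 xca.
have cx : c * (c^-1 * x) = x.
  by case/npo_leP: xca => e ee ->; rewrite !mulgA mulgVg.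
have cx0 : c^-1 * x <> 0 by move=> e; apply: x0; rewrite -cx e mulg0.
have cxa : npo_le (c^-1 * x) a.
  by apply: npo_le_trans (npo_leMl _ xca) _; exact: npo_leVgl.
have [z [z0 zx zb]] := ab _ cx0 cxa.
exists (c * z); split; last exact: npo_leMl.
  move=> cz; apply: z0; case/npo_leP: zx cz => e ee ->.
  rewrite !mulgA -(mulgA c) cx => xe.
  by rewrite -mulgA xe mulg0.
by rewrite -cx; exact: npo_leMl.
Qed.

Lemma lenzV s t : lenz s t -> lenz s^-1 t^-1.
Proof.
suff H a b x : (forall x, x <> 0 -> npo_le x a ->
    exists z, [/\ z <> 0, npo_le z x & npo_le z b]) ->
    x <> 0 -> npo_le x a^-1 ->
    exists z, [/\ z <> 0, npo_le z x & npo_le z b^-1].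
  by move=> /lenzP[st ts]; apply/lenzP; split=> x; exact: H.
move=> ab x0 xa.
have xV0 : x^-1 <> 0 by move=> e; apply: x0; rewrite -[x]invgK e invg0.
have xVa : npo_le x^-1 a by rewrite -[a]invgK; exact: npo_leV.
have [z [z0 zx zb]] := ab _ xV0 xVa.
exists z^-1; split; last exact: npo_leV.
  by move=> e; apply: z0; rewrite -[z]invgK e invg0.
by rewrite -[x]invgK; exact: npo_leV.
Qed.

Lemma lenzM a b c d : lenz a b -> lenz c d -> lenz (a * c) (b * d).
Proof.
move=> ab cd; apply: lenz_trans (lenzMl a cd) _.
by have := lenzV (lenzMl d^-1 (lenzV ab)); rewrite !invgM !invgK.
Qed.

Definition lenz_rel : rel S := fun s t => `[< lenz s t >].

Fact lenz_equiv : equiv_class_of lenz_rel.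
Proof.
split=> [a|a b|b a c].
- by apply/asboolP; exact: lenz_refl.
- by apply/asboolP/asboolP; exact: lenz_sym.
- by move=> /asboolP ab /asboolP bc; apply/asboolP; exact: lenz_trans bc.
Qed.

Canonical lenz_equiv_rel := EquivRelPack lenz_equiv.

Definition lenz_quot := {eq_quot lenz_rel}.

HB.instance Definition _ := Choice.on lenz_quot.
HB.instance Definition _ := EqQuotient.on lenz_quot.

Lemma lenz_quotP s t : \pi_lenz_quot s = \pi_lenz_quot t <-> lenz s t.
Proof.
split=> [/eqmodP/asboolP //|st]; apply/eqmodP; exact/asboolP.
Qed.

Lemma lenz_quotW (x : lenz_quot) : exists a, x = \pi_lenz_quot a.
Proof. by exists (repr x); rewrite reprK. Qed.

Definition lenz_mul (x y : lenz_quot) : lenz_quot :=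
  \pi_lenz_quot (repr x * repr y).
Definition lenz_inv (x : lenz_quot) : lenz_quot :=
  \pi_lenz_quot (repr x)^-1.

Lemma pi_lenz_mul s t :
  lenz_mul (\pi_lenz_quot s) (\pi_lenz_quot t) = \pi_lenz_quot (s * t).
Proof. by apply/lenz_quotP/lenzM; apply/lenz_quotP; rewrite reprK. Qed.

Lemma pi_lenz_inv s : lenz_inv (\pi_lenz_quot s) = \pi_lenz_quot s^-1.
Proof. by apply/lenz_quotP/lenzV; apply/lenz_quotP; rewrite reprK. Qed.

Fact lenz_mulA : associative lenz_mul.
Proof.
move=> x y z; case: (lenz_quotW x) => a ->; case: (lenz_quotW y) => b ->.
case: (lenz_quotW z) => c ->.
by rewrite !pi_lenz_mul mulgA.
Qed.

Fact lenz_mul1g : left_id (\pi_lenz_quot 1) lenz_mul.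
Proof.
by move=> x; case: (lenz_quotW x) => a ->; rewrite pi_lenz_mul mul1g.
Qed.

Fact lenz_invgK : involutive lenz_inv.
Proof.
by move=> x; case: (lenz_quotW x) => a ->; rewrite !pi_lenz_inv invgK.
Qed.

Fact lenz_invgM : {morph lenz_inv : x y / lenz_mul x y >-> lenz_mul y x}.
Proof.
move=> x y; case: (lenz_quotW x) => a ->; case: (lenz_quotW y) => b ->.
by rewrite pi_lenz_mul !pi_lenz_inv invgM pi_lenz_mul.
Qed.

HB.instance Definition _ := isStarMonoid.Build lenz_quot
  lenz_mulA lenz_mul1g lenz_invgK lenz_invgM.

Lemma lenz_piM s t : \pi_lenz_quot (s * t) = \pi_lenz_quot s * \pi_lenz_quot t.
Proof. by rewrite -pi_lenz_mul. Qed.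

Lemma lenz_piV s : \pi_lenz_quot s^-1 = (\pi_lenz_quot s)^-1.
Proof. by rewrite -pi_lenz_inv. Qed.

Lemma lenz_pi1 : \pi_lenz_quot 1 = 1.
Proof. by []. Qed.

Fact lenz_mulgVg (x : lenz_quot) : x * x^-1 * x = x.
Proof.
by case: (lenz_quotW x) => a ->; rewrite -lenz_piV -!lenz_piM mulgVg.
Qed.

Fact lenz_mulgV_comm (x y : lenz_quot) : commute (x * x^-1) (y * y^-1).
Proof.
case: (lenz_quotW x) => a ->; case: (lenz_quotW y) => b ->.
rewrite /commute -!lenz_piV -!lenz_piM.
by rewrite (idempotentC (idempotent_gV a) (idempotent_gV b)).
Qed.

HB.instance Definition _ :=
  StarMonoid_isInverse_eq.Build lenz_quot lenz_mulgVg lenz_mulgV_comm.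

End LenzCongruence.

Section EssentialPart.
Variable S : inverseMonoid0Type.
Local Notation "0" := (@zerog S).

Definition essential (e : S) : Prop :=
  [/\ idempotent_elt e, e <> 0
    & forall f : S, idempotent_elt f -> f <> 0 -> e * f <> 0].

Definition ess_pred : pred S :=
  fun a => `[< essential (a^-1 * a) /\ essential (a * a^-1) >].

Record ess := Ess { ess_val :> S; ess_valP : ess_pred ess_val }.

HB.instance Definition _ := [isSub for ess_val].
HB.instance Definition _ := [Choice of ess by <:].

Lemma essential1 : essential 1.
Proof.
split; [exact: idempotent1 | exact: oneg_neq0 | by move=> f _; rewrite mul1g].
Qed.

Lemma essentialM (a b : S) : essential (a^-1 * a) -> essential (b^-1 * b) ->
  essential ((a * b)^-1 * (a * b)).
Proof.
move=> [ia a0 ea] [ib b0 eb].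
have H (f : S) : idempotent_elt f -> f <> 0 -> (a * b)^-1 * (a * b) * f <> 0.
  move=> ff f0 abf.
  have jf : b * f * b^-1 <> 0.
    move=> bfb; apply: (eb f ff f0).
    rewrite -(idempotent_Vg b) -mulgA (idempotentC ib ff) !mulgA.
    by rewrite -(mulgA _ b f) -(mulgA _ _ b^-1) bfb mulg0 mul0g.
  apply: (ea _ (idempotentJ b ff) jf).
  have -> : a^-1 * a * (b * f * b^-1) =
            b * ((a * b)^-1 * (a * b) * f) * b^-1.
    rewrite invgM !mulgA; congr (_ * _ * _).
    rewrite -(mulgA (b * b^-1)) -(idempotentC ia (idempotent_gV b)) -!mulgA.
    by rewrite (mulgA b) mulgVg.
  by rewrite abf mulg0 mul0g.
split=> //; first exact: idempotent_Vg.
by move=> ab0; apply: (H _ ia a0); rewrite ab0 mul0g.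
Qed.

Fact ess_monoid_closed : monoid_closed ess_pred.
Proof.
split; first by apply/asboolP; rewrite invg1 mulg1; split; exact: essential1.
move=> a b /asboolP[a1 a2] /asboolP[b1 b2]; apply/asboolP.
split; first exact: essentialM.
have := @essentialM b^-1 a^-1; rewrite !invgK invgM invgM !invgK.
exact.
Qed.

HB.instance Definition _ :=
  SubChoice_isSubMonoid.Build S ess_pred ess ess_monoid_closed.

Fact ess_invP (u : ess) : ess_pred (val u)^-1.
Proof.
by have /asboolP[u1 u2] := valP u; apply/asboolP; rewrite invgK.
Qed.

HB.instance Definition _ := hasInv.Build ess (fun u => Ess (ess_invP u)).

Lemma ess_valV (u : ess) : val u^-1 = (val u)^-1.
Proof. by []. Qed.

Fact ess_invgK : involutive (@inv ess).
Proof. by move=> u; apply: val_inj; rewrite !ess_valV invgK. Qed.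

Fact ess_invgM : {morph @inv ess : x y / x * y >-> y * x}.
Proof. by move=> u v; apply: val_inj; rewrite ess_valV !valM invgM. Qed.

HB.instance Definition _ := Monoid_isStarMonoid.Build ess ess_invgK ess_invgM.

Fact ess_mulgVg (u : ess) : u * u^-1 * u = u.
Proof. by apply: val_inj; rewrite !valM ess_valV mulgVg. Qed.

Fact ess_mulgV_comm (u v : ess) : commute (u * u^-1) (v * v^-1).
Proof.
apply: val_inj; rewrite !valM !ess_valV.
exact: idempotentC (idempotent_gV _) (idempotent_gV _).
Qed.

HB.instance Definition _ :=
  StarMonoid_isInverse_eq.Build ess ess_mulgVg ess_mulgV_comm.

End EssentialPart.

Section FreeMonoid.
Variable n : nat.
Local Notation word := (seq 'I_n).
Implicit Types (R X Y : set word) (g h : word -> word -> Prop).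

Definition ideal_gen X : set word := [set x ++ s | x in X & s in setT].

Definition fg_right_ideal R : Prop :=
  exists2 X, finite_set X & R = ideal_gen X.

(* Partial functions on words are represented by their graphs: g x y reads    *)
(* g(x) = y.                                                                  *)
Definition ideal_morphism R1 R2 g : Prop :=
  [/\ forall x y, g x y -> R1 x /\ R2 y,
      forall x, R1 x -> exists! y, g x y
    & forall r y s, g r y -> g (r ++ s) (y ++ s)].

Definition bijective_morphism R1 R2 g : Prop :=
  ideal_morphism R1 R2 g /\ forall y, R2 y -> exists! x, g x y.

Definition D_pred g : bool :=
  `[< exists R1 R2, [/\ fg_right_ideal R1, fg_right_ideal R2
                      & bijective_morphism R1 R2 g] >].

Record Dmonoid := DMonoid {
  graph :> word -> word -> Prop; graphP : D_pred graph }.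

HB.instance Definition _ := [isSub for graph].
HB.instance Definition _ := [Choice of Dmonoid by <:].

Lemma fg_right_idealI R1 R2 :
  fg_right_ideal R1 -> fg_right_ideal R2 -> fg_right_ideal (R1 `&` R2).
Proof.
case=> X finX -> [Y finY ->].
exists ((X `&` ideal_gen Y) `|` (Y `&` ideal_gen X)).
  by rewrite finite_setU; split; exact: finite_setIl.
apply/seteqP; split=> [w [[x Xx [s _ xs]] [y Yy [t _ yt]]]|w [x xP [s _ <-{w}]]].
  have [xy|yx] := leqP (size x) (size y).
    exists y; last by exists t.
    right; split=> //; exists x => //; exists (drop (size x) y) => //.
    have -> : x = take (size x) y.
      move: (congr1 (take (size x)) (etrans xs (esym yt))).
      by rewrite take_size_cat // takel_cat.
    by rewrite size_takel // cat_take_drop.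
  exists x; last by exists s.
  left; split=> //; exists y => //; exists (drop (size y) x) => //.
  have -> : y = take (size y) x.
    move: (congr1 (take (size y)) (etrans yt (esym xs))).
    by rewrite take_size_cat // takel_cat // ltnW.
  by rewrite size_takel ?cat_take_drop // ltnW.
case: xP => -[].
  move=> Xx [y Yy [t _ yt]]; split; first by exists x => //; exists s.
  by exists y => //; exists (t ++ s) => //; rewrite catA yt.
move=> Xx [y Yy [t _ yt]]; split; last by exists x => //; exists s.
by exists y => //; exists (t ++ s) => //; rewrite catA yt.
Qed.

Lemma bijective_morphism_conv R1 R2 g :
  bijective_morphism R1 R2 g -> bijective_morphism R2 R1 (fun x y => g y x).
Proof.
case=> -[gR tot mor] bij; split=> //; split=> //.
by move=> x y /gR[].
by move=> r y s; exact: mor.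
Qed.

Lemma fg_right_ideal_image R1 R2 R g : bijective_morphism R1 R2 g ->
  R `<=` R1 -> fg_right_ideal R ->
  fg_right_ideal [set y | exists2 x, R x & g x y].
Proof.
case=> -[gR tot mor] bij RR1 [X finX defR].
have XR x : X x -> R1 x.
  move=> Xx; apply: RR1; rewrite defR; exists x => //.
  by exists [::]; rewrite ?cats0.
have fun_g x y z : g x y -> g x z -> y = z.
  move=> gxy gxz; have [/tot[w [_ u]] _] := gR _ _ gxy.
  by rewrite -(u _ gxy) -(u _ gxz).
pose f x := xget [::] [set y | g x y].
have fP x : X x -> g x (f x).
  by move=> /XR/tot[y [gxy _]]; rewrite /f; exact: (xgetI _ gxy).
exists (f @` X); first exact: finite_image.
apply/seteqP; split=> [y [w Rw gwy]|y [_ [x Xx <-] [s _ <-{y}]]].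
  move: Rw gwy; rewrite defR => -[x Xx [s _ <-{w}]] gwy.
  exists (f x); first by exists x.
  by exists s => //; exact: fun_g (mor _ _ s (fP _ Xx)) gwy.
exists (x ++ s); last exact/mor/fP.
by rewrite defR; exists x => //; exists s.
Qed.

Definition comp_graph g h : word -> word -> Prop :=
  fun x z => exists2 y, h x y & g y z.

Lemma bijective_morphism_comp R1 R2 S1 S2 g h :
  bijective_morphism S1 S2 g -> bijective_morphism R1 R2 h ->
  bijective_morphism [set x | exists2 y, (R2 `&` S1) y & h x y]
                     [set z | exists2 y, (R2 `&` S1) y & g y z]
                     (comp_graph g h).
Proof.
have unq R R' k : bijective_morphism R R' k ->
    (forall x y z, k x y -> k x z -> y = z) /\
    (forall x y z, k x z -> k y z -> x = y).
  case=> -[kR tot _] bij; split=> x y z kx kz.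
    by have [/tot[w [_ u]] _] := kR _ _ kx; rewrite -(u _ kx) -(u _ kz).
  by have [_ /bij[w [_ u]]] := kR _ _ kx; rewrite -(u _ kx) -(u _ kz).
move=> bg bh; have [fg ig] := unq _ _ _ bg; have [fh ih] := unq _ _ _ bh.
case: bg => -[gR gtot gmor] gbij; case: bh => -[hR htot hmor] hbij.
split; last first.
  move=> z [y [R2y S1y] gyz]; have [x [hxy _]] := hbij _ R2y.
  exists x; split; first by exists y.
  by move=> x' [y' hy' gy']; apply: ih hxy _; rewrite (ig _ _ _ gyz gy').
split.
- move=> x z [y hxy gyz]; have [_ R2y] := hR _ _ hxy.
  by have [S1y _] := gR _ _ gyz; split; exists y.
- move=> x [y [R2y S1y] hxy]; have [z [gyz _]] := gtot _ S1y.
  exists z; split; first by exists y.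
  by move=> z' [y' hy' gy']; apply: fg gyz _; rewrite (fh _ _ _ hxy hy').
- by move=> x z s [y hxy gyz]; exists (y ++ s); [exact: hmor|exact: gmor].
Qed.

Fact D_mulP (f g : Dmonoid) : D_pred (comp_graph f g).
Proof.
have /asboolP[S1 [S2 [fgS1 fgS2 bf]]] := graphP f.
have /asboolP[R1 [R2 [fgR1 fgR2 bg]]] := graphP g.
have fgI := fg_right_idealI fgR2 fgS1.
apply/asboolP; do 2!eexists; split; last exact: bijective_morphism_comp bf bg.
  apply: (fg_right_ideal_image (bijective_morphism_conv bg)) fgI => y [] //.
by apply: (fg_right_ideal_image bf) fgI => y [].
Qed.

Fact D_invP (f : Dmonoid) : D_pred (fun x y => f y x).
Proof.
have /asboolP[S1 [S2 [fgS1 fgS2 bf]]] := graphP f.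
by apply/asboolP; exists S2, S1; split=> //; exact: bijective_morphism_conv.
Qed.

Fact D_oneP : D_pred (fun x y => x = y).
Proof.
have fgT : fg_right_ideal setT.
  exists [set [::]]; first exact: finite_set1.
  by apply/seteqP; split=> // w _; exists [::] => //; exists w.
apply/asboolP; exists setT, setT; split=> //; split; [split=> //|].
- by move=> x _; exists x.
- by move=> r y s ->.
- by move=> x _; exists x; split.
Qed.

Fact D_zeroP : D_pred (fun x y => False).
Proof.
have fg0 : fg_right_ideal set0.
  exists set0; first exact: finite_set0.
  by apply/seteqP; split=> // w [].
by apply/asboolP; exists set0, set0.
Qed.

Definition D_mul (f g : Dmonoid) : Dmonoid := DMonoid (D_mulP f g).
Definition D_inv (f : Dmonoid) : Dmonoid := DMonoid (D_invP f).
Definition D_one : Dmonoid := DMonoid D_oneP.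
Definition D_zero : Dmonoid := DMonoid D_zeroP.

Lemma D_ext (f g : Dmonoid) : (forall x y, f x y <-> g x y) -> f = g.
Proof.
move=> fg; apply: val_inj; apply/funext => x; apply/funext => y.
exact/propext/fg.
Qed.

Lemma D_fun (f : Dmonoid) x y z : f x y -> f x z -> y = z.
Proof.
have /asboolP[S1 [S2 [_ _ [[fR tot _] _]]]] := graphP f => fx fz.
by have [/tot[w [_ u]] _] := fR _ _ fx; rewrite -(u _ fx) -(u _ fz).
Qed.

Lemma D_inj (f : Dmonoid) x y z : f x z -> f y z -> x = y.
Proof. exact: (@D_fun (D_inv f)). Qed.

Fact D_mulA : associative D_mul.
Proof.
move=> f g h; apply: D_ext => x w; split.
  by case=> z [y hxy gyz] fzw; exists y => //; exists z.
by case=> y hxy [z gyz fzw]; exists z => //; exists y.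
Qed.

Fact D_mul1g : left_id D_one D_mul.
Proof.
by move=> f; apply: D_ext => x y; split=> [[z fxz <-]|fxy] //; exists y.
Qed.

Fact D_invgK : involutive D_inv.
Proof. by move=> f; apply: D_ext. Qed.

Fact D_invgM : {morph D_inv : f g / D_mul f g >-> D_mul g f}.
Proof. by move=> f g; apply: D_ext => x y; split=> -[z ? ?]; exists z. Qed.

HB.instance Definition _ :=
  isStarMonoid.Build Dmonoid D_mulA D_mul1g D_invgK D_invgM.

Lemma D_mulgVE (f : Dmonoid) x y :
  (f * f^-1)%g x y <-> x = y /\ exists z, f z x.
Proof.
split=> [[z fzx fzy]|[<- [z fzx]]]; last by exists z.
by split; [exact: (@D_fun f _ _ _ fzx fzy) | exists z].
Qed.

Fact D_mulgVg (f : Dmonoid) : f * f^-1 * f = f.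
Proof.
apply: D_ext => x y; split=> [[z fxz /D_mulgVE[<- _]]|fxy] //.
by exists y => //; apply/D_mulgVE; split=> //; exists x.
Qed.

Fact D_mulgV_comm (f g : Dmonoid) : commute (f * f^-1) (g * g^-1).
Proof.
apply: D_ext => x y; split=> -[z /D_mulgVE[<- ?] /D_mulgVE[<- ?]];
  by exists x; apply/D_mulgVE.
Qed.

HB.instance Definition _ :=
  StarMonoid_isInverse_eq.Build Dmonoid D_mulgVg D_mulgV_comm.

Fact D_mul0g : left_zero D_zero *%g.
Proof. by move=> f; apply: D_ext => x y; split=> // -[]. Qed.

Fact D_mulg0 : right_zero D_zero *%g.
Proof. by move=> f; apply: D_ext => x y; split=> // -[]. Qed.

Fact D_one_neq0 : (1 : Dmonoid) <> D_zero.
Proof. by move=> e; have : (1 : Dmonoid) [::] [::] by []; rewrite e. Qed.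

HB.instance Definition _ :=
  InverseMonoid_hasZero.Build Dmonoid D_mul0g D_mulg0 D_one_neq0.

End FreeMonoid.

Definition Cuntz (n : nat) : inverseMonoidType := lenz_quot (Dmonoid n).

Definition Thompson (n : nat) : groupType := sigma_quot (ess (Dmonoid n)).

(* Main.v *)
(* Call f dense in g when f(x) = y implies g(xs) = ys for some word s. On D_n  *)
(* the Lenz congruence is mutual density, and density is the natural partial  *)
(* order of the quotient. The congruence is idempotent-pure (cancel s), so    *)
(* compatibility in C_n is compatibility in D_n and joins are unions of       *)
(* graphs. Meets are intersections of graphs: two morphisms agreeing at xs    *)
(* agree at x, so their equalizer is finitely generated. A right ideal with   *)
(* generators of length at most N is complemented by the words whose prefix   *)
(* of length N is outside it. Finally an idempotent is essential iff it is    *)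
(* Lenz-congruent to 1, so D_n^e is the preimage of the group of units, on    *)
(* which the Lenz congruence is sigma: congruent elements have a meet that is *)
(* again congruent to both.                                                   *)

Require Import Defs.
From mathcomp Require Import all_boot.
From HB Require Import structures.
From mathcomp Require Import order.
From mathcomp Require Import boolp classical_sets cardinality.

Set Implicit Arguments.
Unset Strict Implicit.
Unset Printing Implicit Defensive.

Local Open Scope classical_set_scope.
Local Open Scope quotient_scope.
Local Open Scope group_scope.

(** The Lenz class of a partial bijection does not change when the graph is thinned out densely: a
    class is determined by what happens after extending words. By [D_lenzP] and [cuntz_leP],
    congruence and order in the quotient are read off graphs. An intersection of graphs then
    represents a meet ([cuntz_meet]). As no new idempotents appear in the quotient
    ([cuntz_idempotentP]), compatible classes have compatible representatives, whose union
    represents the join ([cuntz_join]); composition distributes over unions.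

    For the Boolean algebra only complements remain. Membership in a finitely generated right ideal
    is settled by a prefix of bounded length, so finitely many words generate a disjoint ideal with
    dense union ([fg_right_ideal_compl]).

    For the units, a morphism lies in the essential part iff its class is invertible ([ess_predP]),
    and two such morphisms are congruent iff they have a common essential restriction
    ([ess_unit_sigma]). The class map thus induces the isomorphism [thompson_unit]. *)

Section InverseMonoidFacts.
Variable S : inverseMonoidType.
Implicit Types a b c e f : S.

(** * Natural order and idempotents *)

Lemma npo_le_anti a b : npo_le a b -> npo_le b a -> a = b.
Proof.
case/npo_leP=> e ee ab /npo_leP[f ff ba].
have ae : a * e = a by rewrite ab -mulgA ee.
have be : b * e = b by rewrite ba -mulgA (idempotentC ff ee) mulgA ae.
by rewrite ab be.
Qed.

Lemma is_join_unique a b c d : is_join a b c -> is_join a b d -> c = d.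
Proof.
by move=> [ac bc cm] [ad bd dm]; apply: npo_le_anti; [exact: cm|exact: dm].
Qed.

Lemma idempotent_le1 e : idempotent_elt e <-> npo_le e 1.
Proof.
split=> [ee|/npo_leP[f ff ->]]; last by rewrite mul1g.
by apply/npo_leP; exists e; rewrite ?mul1g.
Qed.

Lemma idempotent_leP e f : idempotent_elt e -> npo_le e f <-> f * e = e.
Proof.
by move=> ee; rewrite /npo_le (idempotentV ee) -mulgA ee; split=> /esym.
Qed.

Lemma idempotent_compatible e f :
  idempotent_elt e -> idempotent_elt f -> compatible e f.
Proof.
by move=> ee ff; split; rewrite idempotentV //; apply: idempotentM.
Qed.

End InverseMonoidFacts.

(** * The Boolean algebra of idempotents *)

Section IdempotentAlgebra.
Variables (S : inverseMonoidType) (z : S).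

(** A criterion for Boolean idempotents: distributivity supplies joins and the distributive law,
    products are meets, so a bottom and complements suffice. The bottom is a parameter because an
    [inverseMonoidType] carries no zero. *)
Definition boolean_idempotents : Prop :=
  [/\ distributive_inverse S, forall a, npo_le z a
    & forall e : S, idempotent_elt e ->
      exists2 f, idempotent_elt f & e * f = z /\ is_join e f 1].

(* The parameter H lets the order instances below be attached to the type. *)
Record idem (H : boolean_idempotents) :=
  Idem { idem_val :> S; _ : `[< idempotent_elt idem_val >] }.

Hypothesis H : boolean_idempotents.
Local Notation B := (idem H).
Implicit Types x y w : B.

HB.instance Definition _ := [isSub of B for @idem_val H].
HB.instance Definition _ := [Choice of B by <:].

Lemma idemP x : idempotent_elt (val x).
Proof. exact/asboolP/(valP x). Qed.

Definition mk_idem (e : S) (ee : idempotent_elt e) : B :=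
  Idem H (introT (asboolP _) ee).

Fact idem_display : Order.disp_t. Proof. exact: Order.Disp tt tt. Qed.

Definition idem_le x y : bool := `[< npo_le (val x) (val y) >].

Fact idem_le_refl : reflexive idem_le.
Proof. by move=> x; apply/asboolP; exact: npo_le_refl. Qed.

Fact idem_le_anti : antisymmetric idem_le.
Proof.
by move=> x y /andP[/asboolP xy /asboolP yx]; exact/val_inj/npo_le_anti.
Qed.

Fact idem_le_trans : transitive idem_le.
Proof.
by move=> y x w /asboolP xy /asboolP yw; apply/asboolP; exact: npo_le_trans yw.
Qed.

HB.instance Definition _ := Order.Le_isPOrder.Build idem_display B
  idem_le_refl idem_le_anti idem_le_trans.

Lemma idem_leP x y : (x <= y)%O <-> npo_le (val x) (val y).
Proof. by split=> /asboolP. Qed.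

Definition idem_meet x y : B := mk_idem (idempotentM (idemP x) (idemP y)).

(** The join is picked by choice; [idem_joinP] shows that the default [x] is harmless. *)
Definition idem_join x y : B :=
  xget x [set w : B | is_join (val x) (val y) (val w)].

Lemma idem_joinP x y : is_join (val x) (val y) (val (idem_join x y)).
Proof.
have [[dist _] _ _] := H.
have [c jc] := dist _ _ (idempotent_compatible (idemP x) (idemP y)).
(* 1 is an upper bound of two idempotents, so their join lies below 1. *)
have cc : idempotent_elt c.
  by case: jc => _ _; rewrite idempotent_le1; apply;
    rewrite -idempotent_le1; exact: idemP.
exact: (@xgetI _ x [set w : B | is_join _ _ (val w)] (mk_idem cc) jc).
Qed.

Fact idem_lexI x y w : (x <= idem_meet y w)%O = (x <= y)%O && (x <= w)%O.
Proof.
have yw := idempotentC (idemP y) (idemP w).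
have Ml (a b : B) : npo_le (val a * val b) (val b).
  by apply/npo_lePl; exists (val a) => //; exact: idemP.
apply/idP/andP=> [/idem_leP xI|[/idem_leP xy /idem_leP xw]].
  split; apply/idem_leP; apply: (npo_le_trans xI) => /=; last exact: Ml.
  by rewrite yw; exact: Ml.
apply/idem_leP; rewrite idempotent_leP; last exact: idemP.
move: xy xw; rewrite !idempotent_leP; try exact: idemP.
by move=> xy xw; rewrite /= -mulgA xw.
Qed.

Fact idem_leUx x y w : (idem_join x y <= w)%O = (x <= w)%O && (y <= w)%O.
Proof.
have [xj yj jm] := idem_joinP x y.
apply/idP/andP=> [/idem_leP jw|[/idem_leP xw /idem_leP yw]].
  by split; apply/idem_leP; exact: npo_le_trans jw.
by apply/idem_leP/jm.
Qed.

HB.instance Definition _ :=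
  Order.POrder_MeetJoin_isLattice.Build idem_display B
    idem_lexI idem_leUx.

Fact idem_meetUl : left_distributive idem_meet idem_join.
Proof.
move=> x y w; apply: val_inj => /=; have [[_ dist] _ _] := H.
have xy := idempotent_compatible (idemP x) (idemP y).
have [_ jw] := dist _ _ _ (val w) xy (idem_joinP x y).
apply: is_join_unique jw _; exact: (idem_joinP (idem_meet x w) (idem_meet y w)).
Qed.

HB.instance Definition _ :=
  Order.Lattice_Meet_isDistrLattice.Build idem_display B idem_meetUl.

Let idem0_idempotent : idempotent_elt z.
Proof. by have [_ z_le _] := H; rewrite idempotent_le1. Qed.

Definition idem0 : B := mk_idem idem0_idempotent.
Definition idem1 : B := mk_idem (idempotent1 S).

Fact idem_le0x x : (idem0 <= x)%O.
Proof. by have [_ z_le _] := H; apply/idem_leP. Qed.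

Fact idem_lex1 x : (x <= idem1)%O.
Proof. by apply/idem_leP/idempotent_le1/idemP. Qed.

HB.instance Definition _ :=
  Order.hasBottom.Build idem_display B idem_le0x.
HB.instance Definition _ :=
  Order.hasTop.Build idem_display B idem_lex1.

Definition idem_compl x : B :=
  xget x [set y : B | val x * val y = z /\ is_join (val x) (val y) 1].

Lemma idem_complP x :
  val x * val (idem_compl x) = z /\ is_join (val x) (val (idem_compl x)) 1.
Proof.
have [_ _ /(_ _ (idemP x))[f ff xf]] := H.
exact: (@xgetI _ x [set y : B | _ * val y = z /\ is_join _ (val y) 1]
  (mk_idem ff) xf).
Qed.

Fact idem_joinxC x : idem_join x (idem_compl x) = idem1.
Proof.
have [_ j1] := idem_complP x.
by apply: val_inj; apply: is_join_unique (idem_joinP _ _) j1.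
Qed.

Fact idem_meetxC x : idem_meet x (idem_compl x) = idem0.
Proof. by apply: val_inj; exact: (idem_complP x).1. Qed.

HB.instance Definition _ :=
  Order.TBDistrLattice_hasComplement.Build idem_display B
    idem_joinxC idem_meetxC.

Lemma boolean_idempotentsW : idempotents_boolean_algebra S.
Proof.
exists idem_display, B, (fun x => val x); split.
- exact: idem_leP.
- exact: idemP.
- by move=> e ee; exists (mk_idem ee).
Qed.

End IdempotentAlgebra.

(** * Finitely generated right ideals and their morphisms *)

Lemma catIs (T : eqType) (s x y : seq T) : x ++ s = y ++ s -> x = y.
Proof.
move=> e; have /eqP := congr1 size e; rewrite !size_cat eqn_add2r => /eqP xy.
by move/eqP: e; rewrite eqseq_cat // eqxx andbT => /eqP.
Qed.

Section PartialBijections.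
Variable n : nat.
Local Notation word := (seq 'I_n).
Local Notation D := (Dmonoid n).
Local Notation C := (Cuntz n).
Implicit Types (f g h e : D) (x y u v s t : word) (R X : set word).

Lemma ideal_gen_cat X x s : ideal_gen X x -> ideal_gen X (x ++ s).
Proof.
by case=> u Xu [t _ <-]; exists u => //; exists (t ++ s); rewrite ?catA.
Qed.

Lemma fg_right_ideal_cat R x s : fg_right_ideal R -> R x -> R (x ++ s).
Proof. by case=> X _ ->; exact: ideal_gen_cat. Qed.

Lemma fg_right_idealU R1 R2 :
  fg_right_ideal R1 -> fg_right_ideal R2 -> fg_right_ideal (R1 `|` R2).
Proof.
move=> [X finX ->] [Y finY ->]; exists (X `|` Y); first by rewrite finite_setU.
apply/seteqP; split=> [w [] [x Xx [s _ <-]]|w [x [Xx|Yx] [s _ <-]]].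
- by exists x; [left|exists s].
- by exists x; [right|exists s].
- by left; exists x => //; exists s.
- by right; exists x => //; exists s.
Qed.

Lemma D_cat f x y s : f x y -> f (x ++ s) (y ++ s).
Proof. by have /asboolP[? [? [_ _ [[_ _ mor] _]]]] := graphP f; exact: mor. Qed.

Definition D_dom f : set word := [set x | exists y, f x y].

Lemma D_dom_fg f : fg_right_ideal (D_dom f).
Proof.
have /asboolP[R1 [R2 [fgR1 _ [[gR tot _] _]]]] := graphP f.
suff -> : D_dom f = R1 by [].
by apply/seteqP; split=> [x [y /gR[]]|x /tot[y [fxy _]]] //; exists y.
Qed.

(** Finite generation is required of the domain alone: the codomain is taken to be the image,
    generated by the images of the generators. *)
Lemma D_predI (g : word -> word -> Prop) :
  (forall x y z, g x y -> g x z -> y = z) ->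
  (forall x y z, g x z -> g y z -> x = y) ->
  (forall x y s, g x y -> g (x ++ s) (y ++ s)) ->
  fg_right_ideal [set x | exists y, g x y] -> D_pred g.
Proof.
move=> fung injg morg fgR; set R := (X in fg_right_ideal X) in fgR.
have bij : bijective_morphism R [set y | exists2 x, R x & g x y] g.
  split; first split=> //.
  - by move=> x y gxy; split; [exists y|exists x => //; exists y].
  - by move=> x [y gxy]; exists y; split=> // z; exact: fung.
  - by move=> y [x _ gxy]; exists x; split=> // z gzy; exact: injg gxy gzy.
apply/asboolP; exists R, [set y | exists2 x, R x & g x y]; split=> //.
exact: fg_right_ideal_image bij _ fgR.
Qed.

Fact D_restr_id_subproof R (fgR : fg_right_ideal R) :
  D_pred (fun x y => R x /\ x = y).
Proof.
apply: D_predI.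
- by move=> x y z [_ <-] [_ <-].
- by move=> x y z [_ ->] [_ ->].
- by move=> x y s [Rx <-]; split=> //; exact: fg_right_ideal_cat.
suff -> : [set x | exists y, R x /\ x = y] = R by [].
by apply/seteqP; split=> x => [[y []]|Rx] //; exists x.
Qed.

Definition D_restr_id R (fgR : fg_right_ideal R) : D :=
  DMonoid (D_restr_id_subproof fgR).

Fact D_cyl_subproof x y : D_pred (fun u v => exists s, u = x ++ s /\ v = y ++ s).
Proof.
apply: D_predI.
- move=> _ _ _ [s [-> ->]] [t [/eqP + ->]].
  by rewrite eqseq_cat // eqxx => /eqP->.
- move=> _ _ _ [s [-> ->]] [t [-> /eqP]].
  by rewrite eqseq_cat // eqxx => /eqP->.
- by move=> _ _ s [t [-> ->]]; exists (t ++ s); rewrite !catA.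
exists [set x]; first exact: finite_set1.
apply/seteqP; split=> [_ [v [s [-> _]]]|_ [_ -> [s _ <-]]].
  by exists x => //; exists s.
by exists (y ++ s), s.
Qed.

(** The map sending [x ++ s] to [y ++ s]. It is the least morphism through the pair ([x], [y]), so
    these maps serve as nonzero test elements below any [f]. *)
Definition D_cyl x y : D := DMonoid (D_cyl_subproof x y).

Fact D_meet_subproof f g : D_pred (fun x y => f x y /\ g x y).
Proof.
apply: D_predI.
- by move=> x y z [fy _] [fz _]; exact: D_fun fy fz.
- by move=> x y z [fx _] [fy _]; exact: D_inj fx fy.
- by move=> x y s [fx gx]; split; exact: D_cat.
have [X finX defX] := fg_right_idealI (D_dom_fg f) (D_dom_fg g).
(* Generators: those of the common domain at which [f] and [g] agree. Agreement at [x ++ s] descends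
   to [x] by cancelling [s]. *)
exists (X `&` [set x | exists y, f x y /\ g x y]); first exact: finite_setIl.
apply/seteqP; split=> [w [y [fwy gwy]]|_ [x [_ [y [fx gx]]] [s _ <-]]].
  have : (D_dom f `&` D_dom g) w by split; exists y.
  rewrite defX => -[x Xx [s _ defw]].
  have : (D_dom f `&` D_dom g) x.
    by rewrite defX; exists x => //; exists [::]; rewrite ?cats0.
  case=> -[u fxu] [v gxv]; exists x; last by exists s.
  split=> //; exists u; split=> //.
  suff /catIs-> : u ++ s = v ++ s by [].
  move: fwy gwy; rewrite -defw => fwy gwy.
  by rewrite -(D_fun fwy (D_cat s fxu)) -(D_fun gwy (D_cat s gxv)).
by exists (y ++ s); split; exact: D_cat.
Qed.

Definition D_meet f g : D := DMonoid (D_meet_subproof f g).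

(** * Order, density and the Lenz congruence *)

Lemma D_idempotentP e : idempotent_elt e <-> forall x y, e x y -> x = y.
Proof.
split=> [ee x y exy|eid].
  have : (e * e)%g x y by rewrite ee.
  case=> z exz ezy; rewrite (D_fun exz exy) in ezy; exact: D_inj exy ezy.
apply: D_ext => x y; split=> [[z exz /eid <-]//|exy].
by exists y => //; move: (exy); rewrite (eid _ _ exy).
Qed.

Lemma D_leP f g : npo_le f g <-> forall x y, f x y -> g x y.
Proof.
split=> [-> x y [z fxz [w fwz gwy]]|fg].
  by rewrite (D_inj fxz fwz).
apply: D_ext => x y; split=> [fxy|[z fxz [w fwz gwy]]].
  by exists y => //; exists x => //; exact: fg.
by rewrite -(D_inj fxz fwz) in gwy; rewrite (D_fun gwy (fg _ _ fxz)).
Qed.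

Lemma D_neq0P f : f <> zerog <-> exists x y, f x y.
Proof.
split=> [f0|[x [y fxy]] f0]; last by rewrite f0 in fxy.
apply: contrapT => nf; apply: f0; apply: D_ext => x y; split=> // fxy.
by apply: nf; exists x, y.
Qed.

Lemma D_cyl_leP f x y : npo_le (D_cyl x y) f <-> f x y.
Proof.
rewrite D_leP; split=> [|fxy _ _ [s [-> ->]]]; last exact: D_cat.
by apply; exists [::]; rewrite !cats0.
Qed.

Lemma D_cyl_neq0 x y : D_cyl x y <> zerog.
Proof. by apply/D_neq0P; exists x, y, [::]; rewrite !cats0. Qed.

Definition dense_in f g : Prop :=
  forall x y, f x y -> exists s, g (x ++ s) (y ++ s).

(** One half of the Lenz condition. A nonzero [h] below [f] contains a pair, whose extension in [g]
    gives a map [D_cyl] below both; conversely [h] is tested on [D_cyl x y], and any pair below it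
    has the form ([x ++ s], [y ++ s]). *)
Lemma dense_in_lenzP f g : dense_in f g <->
  forall h, h <> zerog -> npo_le h f ->
    exists z, [/\ z <> zerog, npo_le z h & npo_le z g].
Proof.
split=> [fg h /D_neq0P[x [y hxy]] /D_leP hf|fg x y fxy].
  have [s gs] := fg _ _ (hf _ _ hxy); exists (D_cyl (x ++ s) (y ++ s)).
  by split; [exact: D_cyl_neq0 | apply/D_cyl_leP/D_cat | apply/D_cyl_leP].
have [h [/D_neq0P[u [v huv]] /D_leP hc /D_leP hg]] :=
  fg _ (@D_cyl_neq0 x y) (proj2 (D_cyl_leP _ _ _) fxy).
by have [s [us vs]] := hc _ _ huv; exists s; rewrite -us -vs; exact: hg.
Qed.

Lemma D_lenzP f g : lenz f g <-> dense_in f g /\ dense_in g f.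
Proof. by rewrite lenzP -!dense_in_lenzP. Qed.

Definition cuntz f : C := \pi_(lenz_quot D) f.

Lemma cuntzM f g : cuntz (f * g) = cuntz f * cuntz g.
Proof. exact: lenz_piM. Qed.

Lemma cuntzV f : cuntz f^-1 = (cuntz f)^-1.
Proof. exact: lenz_piV. Qed.

Lemma cuntz1 : cuntz 1 = 1.
Proof. exact: lenz_pi1. Qed.

Lemma cuntz_surj (a : C) : exists f, a = cuntz f.
Proof. exact: lenz_quotW. Qed.

Lemma cuntzP f g : cuntz f = cuntz g <-> dense_in f g /\ dense_in g f.
Proof. by rewrite -D_lenzP; exact: lenz_quotP. Qed.

Lemma sub_dense_in f g : (forall x y, f x y -> g x y) -> dense_in f g.
Proof. by move=> fg x y fxy; exists [::]; rewrite !cats0; exact: fg. Qed.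

(** The product in [npo_le] is [g] restricted to the domain of [f]. If [f] is dense in [g], then on
    that domain the two values agree after a suitable extension, which gives density both ways. *)
Lemma cuntz_leP f g : npo_le (cuntz f) (cuntz g) <-> dense_in f g.
Proof.
rewrite /npo_le -cuntzV -!cuntzM cuntzP; split=> [[fg _] x y fxy|fg].
  have [s [z fz [w fw gw]]] := fg _ _ fxy; exists s.
  by rewrite (D_inj fz fw).
split=> x y.
  move=> fxy; have [s gs] := fg _ _ fxy; exists s.
  by exists (y ++ s); [exact: D_cat|exists (x ++ s) => //; exact: D_cat].
case=> z fz [w fw gw]; rewrite -(D_inj fz fw) in gw.
have [s gs] := fg _ _ fz; exists s.
by rewrite (D_fun (D_cat s gw) gs); exact: D_cat.
Qed.

(** If [f] sends [x] to [y], density in [f * f] makes [f] send both [x ++ s] and [y ++ s] to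
    [y ++ s] for some [s]; injectivity and cancellation give [x = y]. *)
Lemma cuntz_idempotentP f : idempotent_elt (cuntz f) <-> idempotent_elt f.
Proof.
rewrite {1}/idempotent_elt -cuntzM; split=> [/cuntzP[_ ff]|-> //].
apply/D_idempotentP => x y fxy; have [s [z fz fzy]] := ff _ _ fxy.
have fs := D_cat s fxy; rewrite (D_fun fz fs) in fzy.
exact: catIs (D_inj fs fzy).
Qed.

(** * Meets, joins and distributivity in the quotient *)

Lemma cuntz_meet f g : is_meet (cuntz f) (cuntz g) (cuntz (D_meet f g)).
Proof.
split; [by apply/cuntz_leP/sub_dense_in => x y []..|].
move=> a; case: (cuntz_surj a) => h -> /cuntz_leP hf /cuntz_leP hg.
apply/cuntz_leP => x y hxy; have [s fs] := hf _ _ hxy.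
have [t gt] := hg _ _ (D_cat s hxy); exists (s ++ t); rewrite !catA.
by split=> //; exact: D_cat.
Qed.

Lemma meet_monoid_cuntz : meet_monoid C.
Proof.
move=> a b; case: (cuntz_surj a) => f ->; case: (cuntz_surj b) => g ->.
by exists (cuntz (D_meet f g)); exact: cuntz_meet.
Qed.

(** Compatibility says exactly that the union of the graphs is again a partial bijection. *)
Lemma D_compatibleP f g : compatible f g <->
  (forall x y z, f x y -> g x z -> y = z) /\
  (forall x y z, f x z -> g y z -> x = y).
Proof.
rewrite /compatible !D_idempotentP; split=> [[fg gf]|[fg gf]]; split.
- by move=> x y z fxy gxz; apply/esym/gf; exists x.
- by move=> x y z fxz gyz; apply/esym/fg; exists z.
- by move=> x y [z gxz fyz]; apply/esym/gf; [exact: fyz|exact: gxz].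
- by move=> x y [z gzx fzy]; apply/esym/fg; [exact: fzy|exact: gzx].
Qed.

Lemma cuntz_compatibleP f g :
  compatible (cuntz f) (cuntz g) <-> compatible f g.
Proof.
by rewrite /compatible -!cuntzV -!cuntzM !cuntz_idempotentP.
Qed.

Fact D_join_subproof f g (fg : compatible f g) :
  D_pred (fun x y => f x y \/ g x y).
Proof.
have [fung injg] := proj1 (D_compatibleP f g) fg.
apply: D_predI.
- move=> x y z [fy|gy] [fz|gz].
  + exact: D_fun fy fz.
  + exact: fung fy gz.
  + exact/esym/(fung _ _ _ fz gy).
  + exact: D_fun gy gz.
- move=> x y z [fx|gx] [fy|gy].
  + exact: D_inj fx fy.
  + exact: injg fx gy.
  + exact/esym/(injg _ _ _ fy gx).
  + exact: D_inj gx gy.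
- by move=> x y s [fx|gx]; [left|right]; exact: D_cat.
have := fg_right_idealU (D_dom_fg f) (D_dom_fg g).
congr fg_right_ideal; apply/seteqP; split=> x.
  by case=> -[y xy]; exists y; [left|right].
by case=> y [xy|xy]; [left|right]; exists y.
Qed.

Definition D_join f g (fg : compatible f g) : D := DMonoid (D_join_subproof fg).

Lemma cuntz_join f g (fg : compatible f g) :
  is_join (cuntz f) (cuntz g) (cuntz (D_join fg)).
Proof.
split; first by apply/cuntz_leP/sub_dense_in; left.
  by apply/cuntz_leP/sub_dense_in; right.
move=> a; case: (cuntz_surj a) => h -> /cuntz_leP fh /cuntz_leP gh.
by apply/cuntz_leP => x y [/fh|/gh].
Qed.

Lemma distributive_cuntz : distributive_inverse C.
Proof.
split=> [a b|a b c d].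
  case: (cuntz_surj a) => f ->; case: (cuntz_surj b) => g ->.
  move=> /cuntz_compatibleP fg; exists (cuntz (D_join fg)); exact: cuntz_join.
case: (cuntz_surj a) => f ->; case: (cuntz_surj b) => g ->.
case: (cuntz_surj d) => k -> /cuntz_compatibleP fg jc.
have [fc gc _] := jc; have -> := is_join_unique jc (cuntz_join fg).
rewrite (is_join_unique jc (cuntz_join fg)) in fc gc => {jc}.
(* Upper bounds come from monotonicity of the product; for leastness, a pair of the composite with
   the union comes from one of the two composites. *)
split; (split; [by [exact: npo_leMl|exact: npo_leMr]..|]) => m;
  case: (cuntz_surj m) => h ->; rewrite -!cuntzM !cuntz_leP => fh gh x y.
  by case=> z [fz|gz] kz; [apply: fh|apply: gh]; exists z.
by case=> z kz [fz|gz]; [apply: fh|apply: gh]; exists z.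
Qed.

(** * Complements *)

Lemma fg_right_ideal_bound R : fg_right_ideal R ->
  exists N, forall x, R x -> R (take N x).
Proof.
case=> X /finite_seqP[xs ->] ->; exists (\max_(x <- xs) size x).
move=> _ [x /= xX [s _ <-]].
have xN : size x <= \max_(y <- xs) size y by exact: leq_bigmax_seq.
by rewrite take_cat ltnNge xN; exists x => //; eexists.
Qed.

Lemma fg_right_ideal_compl R : 0 < n -> fg_right_ideal R ->
  exists2 R', fg_right_ideal R' &
    R `&` R' = set0 /\ forall x, exists s, (R `|` R') (x ++ s).
Proof.
move=> n_gt0 fgR; have [N RN] := fg_right_ideal_bound fgR.
(* A word of [R] has its prefix of length [N] in [R], so no word of [R] starts with a word of [W];
   [W] is finite because the alphabet is. *)
pose W := [set w : word | size w = N /\ ~ R w].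
have finW : finite_set W.
  apply: (@sub_finite_set _ _ [set val t | t in [set: N.-tuple 'I_n]]).
    by move=> w [/eqP wN _]; exists (Tuple wN).
  by apply: finite_image; exact: finite_finset.
exists (ideal_gen W); first by exists W.
split=> [|x].
  apply/seteqP; split=> // w [Rw [u [uN Ru] [s _ us]]]; apply: Ru.
  by have := RN _ Rw; rewrite -us take_size_cat.
(* Padding by [N] letters makes the word long enough for its prefix to have length exactly [N], as
   membership in [W] demands. *)
exists (nseq N (Ordinal n_gt0)); set w := x ++ _.
have [Rw|nRw] := pselect (R (take N w)).
  by left; rewrite -(cat_take_drop N w); exact: fg_right_ideal_cat.
right; exists (take N w); last by exists (drop N w) => //; exact: cat_take_drop.
by split=> //; rewrite size_takel // size_cat size_nseq leq_addl.
Qed.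

Lemma boolean_idempotents_cuntz : 0 < n -> boolean_idempotents (cuntz zerog).
Proof.
move=> n_gt0; split; first exact: distributive_cuntz.
  by move=> a; case: (cuntz_surj a) => f ->; apply/cuntz_leP.
move=> a; case: (cuntz_surj a) => f -> /cuntz_idempotentP ff.
have [R' fgR' [disj dense]] := fg_right_ideal_compl n_gt0 (D_dom_fg f).
pose f' := D_restr_id fgR'.
have ff' : idempotent_elt f' by apply/D_idempotentP => x y [].
have fid := proj1 (D_idempotentP f) ff.
exists (cuntz f'); first exact/cuntz_idempotentP.
split.
  rewrite -cuntzM; congr cuntz; apply: D_ext => x y; split=> [|[]].
  case=> _ [Rx <-] fxy; have : (D_dom f `&` R') x by split=> //; exists y.
  by rewrite disj.
have le1 g : idempotent_elt g -> npo_le (cuntz g) 1.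
  by rewrite -idempotent_le1 cuntz_idempotentP.
split; [exact: le1..|].
(* Every word extends into the domain of [f] or into [R'], and both identities are dense in [h];
   composing the two extensions makes 1 dense in [h]. *)
move=> b; case: (cuntz_surj b) => h -> /cuntz_leP fh /cuntz_leP f'h.
rewrite -cuntz1; apply/cuntz_leP => x _ <-; have [s Rs] := dense x.
suff [t ht] : exists t, h ((x ++ s) ++ t) ((x ++ s) ++ t).
  by exists (s ++ t); rewrite catA.
by case: Rs => [[y fxy]|R'x]; [apply: fh; rewrite {2}(fid _ _ fxy)|apply: f'h].
Qed.

(** * Units and the Thompson group *)

Lemma D_essentialP f : essential f <-> idempotent_elt f /\ cuntz f = 1.
Proof.
split=> [[ff _ f_neq0]|[ff f1]].
  split=> //; rewrite -cuntz1; have fid := proj1 (D_idempotentP f) ff.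
  apply/cuntzP; split=> [|x _ <-]; first exact: sub_dense_in.
  (* Testing essentiality on the identity of the ideal generated by [x] yields an extension of [x]
     in the domain of [f]. *)
  have cid : idempotent_elt (D_cyl x x).
    by apply/D_idempotentP => u v [s [-> ->]].
  have /D_neq0P[u [v [w [s [_ ->]] fw]]] := f_neq0 _ cid (@D_cyl_neq0 x x).
  by exists s; rewrite {2}(fid _ _ fw).
have fg_neq0 g : g <> zerog -> f * g <> zerog.
  move=> /D_neq0P[x [y gxy]] fg0.
  (* The class of zero contains only zero, since no pair of [g] extends into an empty graph. *)
  have : cuntz g = cuntz zerog by rewrite -fg0 cuntzM f1 mul1g.
  by move=> /cuntzP[/(_ _ _ gxy)[]].
split=> //; last by move=> g _; exact: fg_neq0.
by rewrite -[f]mulg1; apply: fg_neq0; exact: oneg_neq0.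
Qed.

Lemma ess_predP f : ess_pred f <-> is_unit (cuntz f).
Proof.
split=> [/asboolP[/D_essentialP[_ fV] /D_essentialP[_ Vf]]|/is_unitV[fV Vf]].
  by exists (cuntz f^-1); rewrite -!cuntzM.
apply/asboolP; rewrite !D_essentialP !cuntzM !cuntzV; split; split=> //.
  exact: idempotent_Vg.
exact: idempotent_gV.
Qed.

Fact ess_unit_subproof (u : ess D) : unit_pred (cuntz (val u)).
Proof. exact/asboolP/ess_predP/valP. Qed.

Definition ess_unit (u : ess D) : units C := Units (ess_unit_subproof u).

Lemma ess_unitM : {morph ess_unit : u v / u * v}.
Proof. by move=> u v; apply: val_inj; rewrite valM -[RHS]cuntzM; congr cuntz. Qed.

(** Below a unit, invertible elements are equal to it, so a common lower bound identifies the
    classes. Conversely the intersection of congruent [u] and [v] is congruent to [u], hence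
    essential, and bounds both from below. *)
Lemma ess_unit_sigma (u v : ess D) : ess_unit u = ess_unit v <-> sigma u v.
Proof.
have le_eq (c w : ess D) : npo_le c w -> cuntz (val c) = cuntz (val w).
  move=> /(congr1 val); rewrite !valM ess_valV => ->; rewrite !cuntzM cuntzV.
  have /asboolP/is_unitV[_ cc] := ess_unit_subproof c.
  by rewrite -mulgA cc mulg1.
split=> [/(congr1 val)/= uv|[c [/le_eq cu /le_eq cv]]]; last first.
  by apply: val_inj; rewrite /= -cu cv.
have muE : cuntz (D_meet (val u) (val v)) = cuntz (val u).
  apply/cuntzP; split=> [|x y uxy]; first by apply: sub_dense_in => x y [].
  have [s vs] := proj1 (proj1 (cuntzP _ _) uv) _ _ uxy.
  by exists s; split=> //; exact: D_cat.
have ess_m : ess_pred (D_meet (val u) (val v)).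
  by apply/ess_predP; rewrite muE; apply/ess_predP/valP.
by exists (Ess ess_m); split; apply: val_inj; rewrite !valM ess_valV;
  apply/D_leP => x y [].
Qed.

Lemma ess_unit_surj (a : units C) : exists w, ess_unit w = a.
Proof.
have [f fE] := cuntz_surj (val a).
have ess_f : ess_pred f by apply/ess_predP; rewrite -fE; exact/asboolP/(valP a).
by exists (Ess ess_f); apply: val_inj.
Qed.

(** Defined through a chosen representative; [thompson_unitE] shows that the choice is
    immaterial. *)
Definition thompson_unit (x : Thompson n) : units C :=
  ess_unit (repr (x : sigma_quot (ess D))).

Lemma thompson_unitE (u : ess D) :
  thompson_unit (\pi_(sigma_quot (ess D)) u) = ess_unit u.
Proof. by apply/ess_unit_sigma/sigma_quotP; rewrite reprK. Qed.

Fact thompson_unitM : {morph thompson_unit : x y / x * y}.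
Proof.
move=> x y; case: (sigma_quotW x) => u ->; case: (sigma_quotW y) => v ->.
transitivity (thompson_unit (\pi_(sigma_quot (ess D)) (u * v))).
  by congr thompson_unit; exact: pi_sigma_mul.
by rewrite !thompson_unitE ess_unitM.
Qed.

HB.instance Definition _ := isMultiplicative.Build _ _ thompson_unit
  thompson_unitM.

Lemma thompson_unit_bij : bijective thompson_unit.
Proof.
have inj : injective thompson_unit.
  move=> x y; case: (sigma_quotW x) => u ->; case: (sigma_quotW y) => v ->.
  by rewrite !thompson_unitE => /ess_unit_sigma/sigma_quotP.
have surj (a : units C) : exists z, thompson_unit z = a.
  have [u <-] := ess_unit_surj a; exists (\pi_(sigma_quot (ess D)) u).
  exact: thompson_unitE.
pose g a := sval (cid (surj a)).
have gK a : thompson_unit (g a) = a by rewrite /g; case: cid.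
by exists g => // x; apply: inj.
Qed.

End PartialBijections.

Theorem theorem4p24 (n : nat) (hn : 2 <= n) :
  [/\ boolean_inverse (Cuntz n),
      meet_monoid (Cuntz n)
    & exists phi : {multiplicative Thompson n -> units (Cuntz n)},
        bijective phi].
Proof.
split; last by exists (@thompson_unit n); exact: thompson_unit_bij.
  have n_gt0 : 0 < n by exact: ltnW.
  split; first exact: distributive_cuntz.
  exact: boolean_idempotentsW (boolean_idempotents_cuntz n_gt0).
exact: meet_monoid_cuntz.
Qed.
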